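(* Consider the distributed matrix multiplication problem of computing $C=A^{\intercal}B$, with $A\in\mathbb{F}^{s\times r}$ and $B\in\mathbb{F}^{s\times t}$, using $N$ workers, with parameters $p,m,n$. The optimum linear recovery threshold satisfies $$R(p,m,n)\le K^*_{\textup{linear}}\le 2R(p,m,n)-1,$$ where $R(p,m,n)$ denotes the bilinear complexity (over $\mathbb F$) of multiplying an $m$-by-$p$ matrix and a $p$-by-$n$ matrix.
   Context: Setting. $p,m,n,N,s,r,t$ are positive integers with $p\mid s$, $m\mid r$, $n\mid t$, and $\mathbb{F}$ is a (finite or infinite) field that is sufficiently large, i.e. $|\mathbb F|\ge q_0$ for some threshold $q_0$ depending only on $p,m,n,N$. There are $N$ workers, indexed $0,\dots,N-1$. Bilinear complexity. $R(p,m,n)$ is the minimum integer $R$ for which there exist tensors $a\in\mathbb F^{R\times p\times m}$, $b\in\mathbb F^{R\times p\times n}$, $c\in\mathbb F^{R\times m\times n}$ such that for all matrices $A\in\mathbb F^{p\times m}$, $B\in\mathbb F^{p\times n}$ and all $j,k$, $$\sum_i c_{ijk}\Big(\sum_{j',k'}A_{j'k'}a_{ij'k'}\Big)\Big(\sum_{j'',k''}B_{j''k''}b_{ij''k''}\Big)=\sum_\ell A_{\ell j}B_{\ell k}.$$ A computation strategy consists of encoding functions $\boldsymbol f=(f_0,\dots,f_{N-1})$, $f_i:\mathbb F^{s\times r}\to\mathbb F^{\frac sp\times\frac rm}$, and $\boldsymbol g=(g_0,\dots,g_{N-1})$, $g_i:\mathbb F^{s\times t}\to\mathbb F^{\frac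 sp\times\frac tn}$, together with decoding functions $\boldsymbol d=\{d_{\mathcal K}\}_{\mathcal K\subseteq\{0,\dots,N-1\}}$. Worker $i$ stores $\tilde A_i=f_i(A)$ and $\tilde B_i=g_i(B)$ and returns $\tilde C_i=\tilde A_i^{\intercal}\tilde B_i$; from the results of a subset $\mathcal K$ of workers the master computes the estimate $\hat C=d_{\mathcal K}(\{\tilde C_i\}_{i\in\mathcal K})$. The strategy is $k$-recoverable if for every subset $\mathcal K$ of exactly $k$ workers, $\hat C=A^{\intercal}B$ for all inputs $A,B$. The recovery threshold $K(\boldsymbol f,\boldsymbol g,\boldsymbol d)$ is the minimum integer $k$ such that the strategy is $k$-recoverable. Linear code. Partition $A$ into $p\times m$ equal-size blocks $A_{j,k}\in\mathbb F^{\frac sp\times\frac rm}$ and $B$ into $p\times n$ equal-size blocks $B_{j,k}\in\mathbb F^{\frac sp\times\frac tn}$. A computation strategy is a linear code if there are scalars $a_{ijk},b_{ijk}\in\mathbb F$ with $\tilde A_i=\sum_{j,k}A_{j,k}a_{ijk}$ and $\tilde B_i=\sum_{j,k}B_{j,k}b_{ijk}$ for each worker $i$, and for each $\mathcal K$ there are scalars $c_{ijk}\in\mathbb F$ (which may depend on $\mathcal K$) such that the decoded estimate of the block $C_{j,k}=\sum_{\ell}A_{\ell,j}^{\intercal}B_{\ell,k}$ is $\hat C_{j,k}=\sum_{i\in\mathcal K}\tilde C_i c_{ijk}$. $K^*_{\textup{linear}}$ is the minimum of $K(\boldsymbol f,\boldsymbol g,\boldsymbol d)$ over all linear codes. Standing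 assumption: $N$ is large enough that at least one linear code that is $N$-recoverable exists. *)

(* Defs.v *)
From mathcomp Require Import all_boot all_order all_algebra.
From mathcomp Require Import boolp classical_sets functions cardinality.

Set Implicit Arguments.
Unset Strict Implicit.
Unset Printing Implicit Defensive.

Import GRing.Theory.
Local Open Scope ring_scope.

Lemma least_subproof (P : nat -> Prop) :
  (exists k, P k) -> exists k, `[< P k >].
Proof. by case=> k Pk; exists k; apply/asboolP. Qed.

Definition least (P : nat -> Prop) (exP : exists k, P k) : nat :=
  ex_minn (least_subproof exP).

Definition has_bilinear_algorithm (F : fieldType) (p m n R : nat) : Prop :=
  exists (a : 'I_R -> 'M[F]_(p, m)) (b : 'I_R -> 'M[F]_(p, n))
         (c : 'I_R -> 'M[F]_(m, n)),
  forall (A : 'M[F]_(p, m)) (B : 'M[F]_(p, n)) (j : 'I_m) (k : 'I_n),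
    \sum_(i < R) c i j k
       * (\sum_(j' < p) \sum_(k' < m) A j' k' * a i j' k')
       * (\sum_(j' < p) \sum_(k' < n) B j' k' * b i j' k')
    = \sum_(l < p) A l j * B l k.

(* The schoolbook algorithm, with p * m * n products. *)
Lemma ex_bilinear_algorithm (F : fieldType) (p m n : nat) :
  exists R, has_bilinear_algorithm F p m n R.
Proof.
have sum_delta (u v : nat) (M : 'M[F]_(u, v)) (x : 'I_u) (y : 'I_v) :
    \sum_(j < u) \sum_(k < v) M j k * delta_mx x y j k = M x y.
  rewrite (bigD1 x) //= (bigD1 y) //= mxE !eqxx mulr1.
  rewrite big1 ?addr0 => [|k /negPf kF]; last by rewrite mxE kF andbF mulr0.
  rewrite big1 ?addr0 // => j /negPf jF.
  by rewrite big1 // => k _; rewrite mxE jF mulr0.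
exists #|{: 'I_p * 'I_m * 'I_n}|.
exists (fun i => delta_mx (enum_val i).1.1 (enum_val i).1.2).
exists (fun i => delta_mx (enum_val i).1.1 (enum_val i).2).
exists (fun i => delta_mx (enum_val i).1.2 (enum_val i).2) => A B j k.
under eq_bigr do rewrite !sum_delta.
rewrite -(big_enum_val (A := {: 'I_p * 'I_m * 'I_n})
  (fun z : 'I_p * 'I_m * 'I_n =>
     delta_mx z.1.2 z.2 j k * A z.1.1 z.1.2 * B z.1.1 z.2)) /=.
rewrite -(pair_bigA _ (fun (x : 'I_p * 'I_m) (y : 'I_n) =>
  delta_mx x.2 y j k * A x.1 x.2 * B x.1 y)) /=.
rewrite -(pair_bigA _ (fun (x : 'I_p) (z : 'I_m) => \sum_(y < n)
  delta_mx z y j k * A x z * B x y)) /=.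
apply: eq_bigr => l _.
rewrite (bigD1 j) //= (bigD1 k) //= mxE !eqxx mul1r.
rewrite big1 ?addr0 => [|y]; last first.
  by rewrite eq_sym => /negPf yF; rewrite mxE yF andbF !mul0r.
rewrite big1 ?addr0 // => z; rewrite eq_sym => /negPf zF.
by rewrite big1 // => y _; rewrite mxE zF !mul0r.
Qed.

Definition bilinear_complexity (F : fieldType) (p m n : nat) : nat :=
  least (ex_bilinear_algorithm F p m n).

Lemma block_index_subproof (p s : nat) (hs : (p %| s)%N)
  (j : 'I_p) (x : 'I_(s %/ p)) : (j * (s %/ p) + x < s)%N.
Proof.
apply: (@leq_trans (j.+1 * (s %/ p))).
  by rewrite mulSn addnC ltn_add2r.
by rewrite -{2}(divnK hs) mulnC leq_mul2l ltn_ord orbT.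
Qed.

(* The x-th index of the j-th of p consecutive intervals partitioning 'I_s. *)
Definition block_index (p s : nat) (hs : (p %| s)%N) (j : 'I_p)
  (x : 'I_(s %/ p)) : 'I_s := Ordinal (block_index_subproof hs j x).

Definition block (F : fieldType) (p m s r : nat) (hs : (p %| s)%N) (hr : (m %| r)%N)
  (A : 'M[F]_(s, r)) (j : 'I_p) (k : 'I_m) : 'M[F]_(s %/ p, r %/ m) :=
  mxsub (block_index hs j) (block_index hr k) A.

Record strategy (F : fieldType) (p m n N s r t : nat) := Strategy {
  encA : 'I_N -> 'M[F]_(s, r) -> 'M[F]_(s %/ p, r %/ m);
  encB : 'I_N -> 'M[F]_(s, t) -> 'M[F]_(s %/ p, t %/ n);
  dec : forall K : {set 'I_N},
    ({i : 'I_N | i \in K} -> 'M[F]_(r %/ m, t %/ n)) -> 'M[F]_(r, t)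
}.

Definition worker_result (F : fieldType) (p m n N s r t : nat)
  (S : strategy F p m n N s r t) (A : 'M[F]_(s, r)) (B : 'M[F]_(s, t))
  (i : 'I_N) : 'M[F]_(r %/ m, t %/ n) :=
  (encA S i A)^T *m encB S i B.

Definition estimate (F : fieldType) (p m n N s r t : nat)
  (S : strategy F p m n N s r t) (K : {set 'I_N})
  (A : 'M[F]_(s, r)) (B : 'M[F]_(s, t)) : 'M[F]_(r, t) :=
  dec S (fun i : {i : 'I_N | i \in K} => worker_result S A B (val i)).

Definition recoverable (F : fieldType) (p m n N s r t : nat)
  (S : strategy F p m n N s r t) (k : nat) : Prop :=
  forall K : {set 'I_N}, #|K| = k ->
  forall (A : 'M[F]_(s, r)) (B : 'M[F]_(s, t)), estimate S K A B = A^T *m B.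

Lemma ex_recoverable (F : fieldType) (p m n N s r t : nat)
  (S : strategy F p m n N s r t) : exists k, recoverable S k.
Proof.
exists N.+1 => K cK; have := max_card (mem K).
by rewrite cK card_ord ltnn.
Qed.

(* Since k = N.+1 is vacuously recoverable, the threshold is N.+1 exactly when
   the strategy is k-recoverable for no k <= N. *)
Definition recovery_threshold (F : fieldType) (p m n N s r t : nat)
  (S : strategy F p m n N s r t) : nat := least (ex_recoverable S).

Definition linear_code (F : fieldType) (p m n N s r t : nat)
  (hs : (p %| s)%N) (hr : (m %| r)%N) (ht : (n %| t)%N)
  (S : strategy F p m n N s r t) : Prop :=
  [/\ exists a : 'I_N -> 'M[F]_(p, m), forall i A,
        encA S i A = \sum_(j < p) \sum_(k < m) a i j k *: block hs hr A j k,
      exists b : 'I_N -> 'M[F]_(p, n), forall i B,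
        encB S i B = \sum_(j < p) \sum_(k < n) b i j k *: block hs ht B j k
    & forall K : {set 'I_N}, exists c : 'I_N -> 'M[F]_(m, n),
      forall A B (j : 'I_m) (k : 'I_n),
        block hr ht (estimate S K A B) j k
        = \sum_(i in K) c i j k *: worker_result S A B i].

Lemma ex_linear_threshold (F : fieldType) (p m n N s r t : nat)
  (hs : (p %| s)%N) (hr : (m %| r)%N) (ht : (n %| t)%N) :
  exists k, exists2 S : strategy F p m n N s r t,
    linear_code hs hr ht S & recovery_threshold S = k.
Proof.
pose S := @Strategy F p m n N s r t (fun _ _ => 0) (fun _ _ => 0)
  (fun _ _ => 0).
exists (recovery_threshold S), S => //; split.
- exists (fun=> 0) => i A; rewrite big1 // => j _; rewrite big1 // => k _.
  by rewrite mxE scale0r.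
- exists (fun=> 0) => i A; rewrite big1 // => j _; rewrite big1 // => k _.
  by rewrite mxE scale0r.
move=> K; exists (fun=> 0) => A B j k; rewrite big1 => [|i _].
  by apply/matrixP => x y; rewrite !mxE.
by rewrite mxE scale0r.
Qed.

Definition optimum_linear_threshold (F : fieldType) (p m n N s r t : nat)
  (hs : (p %| s)%N) (hr : (m %| r)%N) (ht : (n %| t)%N) : nat :=
  least (ex_linear_threshold F N hs hr ht).

(* Main.v *)
(* Lower bound: on inputs whose blocks are multiples of an elementary matrix,
   each worker performs one scalar multiplication, so the linear decoding from
   any recovering set of k workers is a bilinear algorithm with k products.
   Upper bound: given a bilinear algorithm with R products, encode A and B by
   the matrix polynomials of degree R - 1 whose values at R nodes x_l are the
   factors of the l-th product, and let worker i evaluate them at y_i. The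
   workers' results are values of a polynomial of degree 2R - 2, hence any
   2R - 1 of them determine its values at the nodes x_l, which are the R
   products. If 2R - 1 >= N, the assumed N-recoverable code already suffices;
   otherwise R <= N, and N field elements are enough, since the nodes can be
   taken among the y_i. *)
Require Import Defs.
From mathcomp Require Import all_boot all_order all_algebra.
From mathcomp Require Import boolp classical_sets functions cardinality.

Set Implicit Arguments.
Unset Strict Implicit.
Unset Printing Implicit Defensive.

Import GRing.Theory.
Local Open Scope ring_scope.

Lemma leastP (P : nat -> Prop) (exP : exists k, P k) : P (least exP).
Proof. by rewrite /least; case: ex_minnP => k /asboolP. Qed.

Lemma least_le (P : nat -> Prop) (exP : exists k, P k) k :
  P k -> (least exP <= k)%N.
Proof.
by move=> Pk; rewrite /least; case: ex_minnP => l _; apply; apply/asboolP.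
Qed.

(** * Splitting indices and matrices into blocks *)

Section Blocks.
Variables (p s : nat) (hs : (p %| s)%N).

Lemma block_size_gt0 : (0 < s)%N -> (0 < s %/ p)%N.
Proof.
by move=> s0; rewrite divn_gt0; [apply: dvdn_leq | apply: dvdn_gt0 hs].
Qed.

Lemma block_outer_subproof (x : 'I_s) : (x %/ (s %/ p) < p)%N.
Proof.
have s0 : (0 < s)%N by apply: leq_ltn_trans (ltn_ord x).
by rewrite ltn_divLR ?block_size_gt0 // mulnC divnK.
Qed.

Lemma block_inner_subproof (x : 'I_s) : (x %% (s %/ p) < s %/ p)%N.
Proof.
by rewrite ltn_mod block_size_gt0 //; apply: leq_ltn_trans (ltn_ord x).
Qed.

Definition block_split (x : 'I_s) : 'I_p * 'I_(s %/ p) :=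
  (Ordinal (block_outer_subproof x), Ordinal (block_inner_subproof x)).

Lemma block_splitK x :
  block_index hs (block_split x).1 (block_split x).2 = x.
Proof. by apply: val_inj; rewrite /= -divn_eq. Qed.

Lemma block_indexK j x : block_split (block_index hs j x) = (j, x).
Proof.
have s0 : (0 < s %/ p)%N by apply: leq_ltn_trans (ltn_ord x).
congr pair; apply: val_inj => /=.
  by rewrite divnMDl // divn_small ?addn0.
by rewrite modnMDl modn_small.
Qed.

Lemma sum_block_index (V : nmodType) (f : 'I_s -> V) :
  \sum_x f x = \sum_j \sum_y f (block_index hs j y).
Proof.
rewrite pair_bigA /= (reindex (fun z => block_index hs z.1 z.2)) //=.
exists block_split => [[j y] _|x _]; first exact: block_indexK.
exact: block_splitK.
Qed.

End Blocks.

Section BlockMatrix.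
Variables (F : fieldType) (p m n s r t : nat).
Variables (hs : (p %| s)%N) (hr : (m %| r)%N) (ht : (n %| t)%N).

Definition unblock (G : 'I_p -> 'I_m -> 'M[F]_(s %/ p, r %/ m)) :
  'M[F]_(s, r) :=
  \matrix_(x, y) G (block_split hs x).1 (block_split hr y).1
                   (block_split hs x).2 (block_split hr y).2.

Lemma unblockK G j k : block hs hr (unblock G) j k = G j k.
Proof. by apply/matrixP => x y; rewrite !mxE !block_indexK. Qed.

Lemma block_inj (A B : 'M[F]_(s, r)) :
  (forall j k, block hs hr A j k = block hs hr B j k) -> A = B.
Proof.
move=> eqAB; apply/matrixP => x y.
have /matrixP/(_ (block_split hs x).2 (block_split hr y).2) :=
  eqAB (block_split hs x).1 (block_split hr y).1.
by rewrite !mxE !block_splitK.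
Qed.

Lemma block_trmx_mul (A : 'M[F]_(s, r)) (B : 'M[F]_(s, t)) j k :
  block hr ht (A^T *m B) j k
  = \sum_l (block hs hr A l j)^T *m block hs ht B l k.
Proof.
apply/matrixP => x y; rewrite !mxE summxE (sum_block_index hs).
apply: eq_bigr => l _; rewrite mxE.
by apply: eq_bigr => u _; rewrite !mxE.
Qed.

End BlockMatrix.

(** Without products an algorithm outputs only zeros, while two elementary matrices can have a
    product with an entry 1. Positivity gives [R <= 2 * R - 1] despite truncated subtraction. *)
Lemma bilinear_complexity_gt0 (F : fieldType) (p m n : nat) :
  (0 < p)%N -> (0 < m)%N -> (0 < n)%N -> (0 < bilinear_complexity F p m n)%N.
Proof.
case: p m n => [|p] [|m] [|n] // _ _ _.
have := leastP (ex_bilinear_algorithm F p.+1 m.+1 n.+1).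
rewrite -/(bilinear_complexity _ _ _ _) lt0n.
move: (bilinear_complexity _ _ _ _) => R algR; apply/eqP => R0.
move: algR; rewrite R0 => -[a [b [c /(_ (delta_mx 0 0) (delta_mx 0 0) 0 0)]]].
rewrite big_ord0 big_ord_recl big1 => [|l _]; last by rewrite !mxE mul0r.
by rewrite !mxE mulr1 addr0 => /esym/eqP; rewrite oner_eq0.
Qed.

(** * Lagrange interpolation on a finite set of nodes *)

Section Lagrange.
Variables (F : fieldType) (I : finType) (y : I -> F).

Definition lagrange_basis (K : {set I}) (i : I) : {poly F} :=
  \prod_(j in K :\ i) ((y i - y j)^-1 *: ('X - (y j)%:P)).

Lemma size_lagrange_basis (K : {set I}) i :
  i \in K -> (size (lagrange_basis K i) <= #|K|)%N.
Proof.
move=> iK; rewrite /lagrange_basis scaler_prod.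
apply: leq_trans (size_scale_leq _ _) _.
by rewrite -big_enum size_prod_XsubC -cardE (cardsD1 i K) iK.
Qed.

Lemma lagrange_basis_eval (K : {set I}) i j :
  injective y -> i \in K -> j \in K -> (lagrange_basis K i).[y j] = (i == j)%:R.
Proof.
move=> y_inj iK jK; rewrite horner_prod; have [<-|ij] := eqVneq i j.
  rewrite big1 // => k; rewrite !inE => /andP[ki _].
  by rewrite !hornerE mulVf // subr_eq0 (inj_eq y_inj) eq_sym.
rewrite (bigD1 j) /=; last by rewrite !inE eq_sym ij.
by rewrite !hornerE subrr mulr0 mul0r.
Qed.

(** The difference of the two sides has size at most [#|K|] but vanishes at [#|K|] distinct points,
    so it is zero. *)
Lemma lagrange_interpolation (K : {set I}) (P : {poly F}) :
  injective y -> (size P <= #|K|)%N ->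
  P = \sum_(i in K) P.[y i] *: lagrange_basis K i.
Proof.
move=> y_inj sP; apply/eqP; rewrite -subr_eq0; apply/negPn/negP => D0.
have sD : (size (P - \sum_(i in K) P.[y i] *: lagrange_basis K i)%R <= #|K|)%N.
  apply: leq_trans (size_polyD _ _) _; rewrite geq_max sP size_polyN.
  apply: leq_trans (size_sum _ _ _) _; apply/bigmax_leqP => i iK.
  exact: leq_trans (size_scale_leq _ _) (size_lagrange_basis iK).
have := max_poly_roots (rs := [seq y i | i <- enum K]) D0.
rewrite map_inj_uniq // enum_uniq size_map -cardE ltnNge sD.
move=> noroot; suff: false by []; apply: noroot => //.
apply/allP => _ /mapP[j + ->]; rewrite mem_enum => jK.
rewrite rootE hornerD hornerN horner_sum (bigD1 j) //= big1 ?addr0.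
  by rewrite hornerZ lagrange_basis_eval // eqxx mulr1 subrr.
move=> i /andP[iK /negPf ij].
by rewrite hornerZ lagrange_basis_eval // ij mulr0.
Qed.

End Lagrange.

(** * Lower bound: from a linear code to a bilinear algorithm *)

Section Converse.
Variables (F : fieldType) (p m n N s r t : nat).
Variables (hs : (p %| s)%N) (hr : (m %| r)%N) (ht : (n %| t)%N).
Hypotheses (s_gt0 : (0 < s)%N) (r_gt0 : (0 < r)%N) (t_gt0 : (0 < t)%N).

Lemma linear_code_bilinear_algorithm (S : strategy F p m n N s r t)
    (K : {set 'I_N}) :
  linear_code hs hr ht S ->
  (forall A B, estimate S K A B = A^T *m B) ->
  has_bilinear_algorithm F p m n #|K|.
Proof.
move=> [[a aE] [b bE] /(_ K)[c cE]] recK.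
pose u0 := Ordinal (block_size_gt0 hs s_gt0).
pose x0 := Ordinal (block_size_gt0 hr r_gt0).
pose y0 := Ordinal (block_size_gt0 ht t_gt0).
exists (fun i => a (enum_val i)), (fun i => b (enum_val i)),
  (fun i => c (enum_val i)) => A B j k.
(* Each scalar entry is placed at one fixed position of its block. The encodings are then multiples
   of a single elementary matrix, and a worker's result is determined by its entry at [x0], [y0], a
   product of two linear forms. *)
pose A' := unblock hs hr (fun j k => A j k *: delta_mx u0 x0).
pose B' := unblock hs ht (fun j k => B j k *: delta_mx u0 y0).
have encA' i : encA S i A' =
    (\sum_j \sum_k A j k * a i j k) *: delta_mx u0 x0.
  rewrite aE scaler_suml; apply: eq_bigr => l _.
  rewrite scaler_suml; apply: eq_bigr => q _.
  by rewrite unblockK scalerA mulrC.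
have encB' i : encB S i B' =
    (\sum_j \sum_k B j k * b i j k) *: delta_mx u0 y0.
  rewrite bE scaler_suml; apply: eq_bigr => l _.
  rewrite scaler_suml; apply: eq_bigr => q _.
  by rewrite unblockK scalerA mulrC.
have mul_delta (x y : F) :
    ((x *: delta_mx u0 x0)^T *m (y *: delta_mx u0 y0)) x0 y0 = x * y.
  rewrite -scalemxAr linearZ /= trmx_delta -scalemxAl mul_delta_mx.
  by rewrite !mxE !eqxx mulr1 mulrC.
have := cE A' B' j k; rewrite recK (block_trmx_mul hs).
move/matrixP/(_ x0 y0); rewrite !summxE => eqAB.
rewrite -(big_enum_val (fun i => c i j k
  * (\sum_j' \sum_k' A j' k' * a i j' k')
  * (\sum_j' \sum_k' B j' k' * b i j' k'))) /=.
under [RHS]eq_bigr do rewrite -mul_delta.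
transitivity (\sum_(i in K) (c i j k *: worker_result S A' B' i) x0 y0).
  by apply: eq_bigr => i _;
    rewrite /worker_result encA' encB' [RHS]mxE mul_delta mulrA.
by rewrite -eqAB; apply: eq_bigr => l _; rewrite !unblockK.
Qed.

End Converse.

(** * Upper bound: from a bilinear algorithm to a linear code *)

Section EntangledPolynomialCode.
Variables (F : fieldType) (p m n N R s r t : nat).
Variables (hs : (p %| s)%N) (hr : (m %| r)%N) (ht : (n %| t)%N).
Variables (y : 'I_N -> F) (leRN : (R <= N)%N).
Variables (a : 'I_R -> 'M[F]_(p, m)) (b : 'I_R -> 'M[F]_(p, n)).
Variable c : 'I_R -> 'M[F]_(m, n).

(** The encoding nodes are the evaluation points of the first [R] workers. For injective [y], these
    workers thus compute the bare products of the algorithm. *)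
Let node (l : 'I_R) : F := y (widen_ord leRN l).
Let basis (l : 'I_R) : {poly F} := lagrange_basis node [set: 'I_R] l.

Definition entangled_coef (u v : nat) (M : 'I_R -> 'M[F]_(u, v)) (i : 'I_N) :
  'M[F]_(u, v) := \sum_l (basis l).[y i] *: M l.

(** Interpolation from the workers in [K] gives the value at [node l] with weight [(lagrange_basis y
    K i).[node l]] on worker [i]; the algorithm weights this value by [c l]. Exchanging the two sums
    leaves this coefficient. *)
Definition entangled_decoder (K : {set 'I_N}) (i : 'I_N) : 'M[F]_(m, n) :=
  \sum_l (lagrange_basis y K i).[node l] *: c l.

Definition entangled_code : strategy F p m n N s r t :=
  @Strategy F p m n N s r t
    (fun i A => \sum_j \sum_k entangled_coef a i j k *: block hs hr A j k)
    (fun i B => \sum_j \sum_k entangled_coef b i j k *: block hs ht B j k)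
    (fun K res => unblock hr ht (fun j k =>
       \sum_i entangled_decoder K (val i) j k *: res i)).

Lemma entangled_code_estimate (K : {set 'I_N}) A B j k :
  block hr ht (estimate entangled_code K A B) j k
  = \sum_(i in K)
      entangled_decoder K i j k *: worker_result entangled_code A B i.
Proof.
by rewrite unblockK [RHS]big_sub.
Qed.

Lemma linear_entangled_code : linear_code hs hr ht entangled_code.
Proof.
split; [by exists (entangled_coef a) | by exists (entangled_coef b) |].
by move=> K; exists (entangled_decoder K) => A B j k;
  rewrite entangled_code_estimate.
Qed.

(** For injective [y], its value at [node l] is the l-th product of the algorithm on [A] and [B]. *)
Let product_poly (A : 'M[F]_(p, m)) (B : 'M[F]_(p, n)) : {poly F} :=
  (\sum_l (\sum_j \sum_k A j k * a l j k) *: basis l)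
  * (\sum_l (\sum_j \sum_k B j k * b l j k) *: basis l).

Lemma size_basis_sum (f : 'I_R -> F) : (size (\sum_l f l *: basis l)%R <= R)%N.
Proof.
apply: leq_trans (size_sum _ _ _) _; apply/bigmax_leqP => l _.
apply: leq_trans (size_scale_leq _ _) _.
apply: leq_trans (size_lagrange_basis _ (finset.in_setT l)) _.
by rewrite cardsT card_ord.
Qed.

(** Pairing with [X] is linear, so it commutes with the combination of the [M l] by basis
    polynomials. This identifies a worker's scalar encodings with values of the factors of
    [product_poly]. *)
Lemma sum_entangled_coef (u v : nat) (M : 'I_R -> 'M[F]_(u, v)) i
    (X : 'M[F]_(u, v)) :
  \sum_j \sum_k entangled_coef M i j k * X j k
  = (\sum_l (\sum_j \sum_k X j k * M l j k) *: basis l).[y i].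
Proof.
rewrite horner_sum.
under [RHS]eq_bigr => l _ do rewrite hornerZ mulr_suml.
rewrite [RHS]exchange_big /=; apply: eq_bigr => j _.
under [RHS]eq_bigr => l _ do rewrite mulr_suml.
rewrite [RHS]exchange_big /=; apply: eq_bigr => k _.
rewrite summxE mulr_suml; apply: eq_bigr => l _.
by rewrite mxE mulrC -mulrA (mulrC (M l j k)).
Qed.

Hypothesis y_inj : injective y.
Hypothesis alg_abc : forall (A : 'M[F]_(p, m)) (B : 'M[F]_(p, n)) j k,
  \sum_i c i j k * (\sum_j' \sum_k' A j' k' * a i j' k')
    * (\sum_j' \sum_k' B j' k' * b i j' k') = \sum_l A l j * B l k.

Lemma node_eval (f : 'I_R -> F) l : (\sum_q f q *: basis q).[node l] = f l.
Proof.
have node_inj : injective node.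
  by move=> l1 l2 /y_inj/(congr1 val)/= /val_inj.
rewrite horner_sum (bigD1 l) //= big1 => [|q /negPf ql].
  by rewrite hornerZ lagrange_basis_eval ?inE // eqxx mulr1 addr0.
by rewrite hornerZ lagrange_basis_eval ?inE // ql mulr0.
Qed.

Lemma entangled_decoderE (K : {set 'I_N}) A B j k : (2 * R - 1 <= #|K|)%N ->
  \sum_(i in K) entangled_decoder K i j k * (product_poly A B).[y i]
  = \sum_l A l j * B l k.
Proof.
move=> leK.
(* Both factors have size at most [R], so the product has size at most [R + R - 1]. *)
have sP : (size (product_poly A B) <= #|K|)%N.
  apply: leq_trans leK; apply: leq_trans (size_polyMleq _ _) _.
  rewrite -subn1 leq_sub2r // mul2n -addnn.
  by rewrite leq_add ?size_basis_sum.
rewrite -alg_abc.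
transitivity (\sum_l c l j k * (product_poly A B).[node l]); last first.
  by apply: eq_bigr => l _; rewrite hornerM !node_eval mulrA.
under [RHS]eq_bigr => l _.
  rewrite (lagrange_interpolation y_inj sP) horner_sum mulr_sumr; over.
rewrite exchange_big /=; apply: eq_bigr => i _.
rewrite summxE mulr_suml; apply: eq_bigr => l _.
by rewrite mxE hornerZ [RHS]mulrC -[RHS]mulrA [RHS]mulrC.
Qed.

(** The scalar identity [entangled_decoderE] lifts to blocks entry by entry, because encoding and
    decoding only take linear combinations of blocks. *)
Lemma recoverable_entangled_code : recoverable entangled_code (2 * R - 1).
Proof.
move=> K cK A B; apply: (block_inj (hs := hr) (hr := ht)) => j k.
rewrite entangled_code_estimate (block_trmx_mul hs); apply/matrixP => x z.
(* For fixed [u], the entries at [(u, x)] of all blocks of [A] form one scalar input, and those at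
   [(u, z)] of all blocks of [B] the other. Summing over [u] gives entry [(x, z)] of the block
   product. *)
pose A' u : 'M[F]_(p, m) := \matrix_(j, k) block hs hr A j k u x.
pose B' u : 'M[F]_(p, n) := \matrix_(j, k) block hs ht B j k u z.
transitivity (\sum_u \sum_l A' u l j * B' u l k); last first.
  rewrite summxE exchange_big; apply: eq_bigr => l _; rewrite mxE.
  by apply: eq_bigr => u _; rewrite ![in RHS]mxE !mxE.
under [RHS]eq_bigr => u _ do rewrite -(@entangled_decoderE K) ?cK //.
rewrite exchange_big summxE; apply: eq_bigr => i _.
rewrite -mulr_sumr mxE; congr (_ * _); rewrite mxE; apply: eq_bigr => u _.
rewrite hornerM -!sum_entangled_coef mxE !summxE; congr (_ * _).
  apply: eq_bigr => l _; rewrite summxE; apply: eq_bigr => q _.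
  by rewrite [LHS]mxE [A' _ _ _]mxE.
apply: eq_bigr => l _; rewrite summxE; apply: eq_bigr => q _.
by rewrite [LHS]mxE [B' _ _ _]mxE.
Qed.

End EntangledPolynomialCode.

Theorem theorem3 (p m n N : nat)
  (p_gt0 : (0 < p)%N) (m_gt0 : (0 < m)%N) (n_gt0 : (0 < n)%N)
  (N_gt0 : (0 < N)%N) :
  exists q0 : nat,
  forall (F : fieldType) (s r t : nat),
    (0 < s)%N -> (0 < r)%N -> (0 < t)%N ->
  forall (hs : (p %| s)%N) (hr : (m %| r)%N) (ht : (n %| t)%N),
    (`I_q0 #<= [set: F]%classic)%card ->
    (exists2 S : strategy F p m n N s r t,
       linear_code hs hr ht S & recoverable S N) ->
    (bilinear_complexity F p m n <= optimum_linear_threshold F N hs hr ht)%N /\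
    (optimum_linear_threshold F N hs hr ht
       <= 2 * bilinear_complexity F p m n - 1)%N.
Proof.
(* The threshold [N] provides one distinct evaluation point per worker. *)
exists N => F s r t s_gt0 r_gt0 t_gt0 hs hr ht cardF [S linS recS].
have threshold_le (T : strategy F p m n N s r t) k : linear_code hs hr ht T ->
    recoverable T k -> (optimum_linear_threshold F N hs hr ht <= k)%N.
  move=> linT recT; apply: (@leq_trans (recovery_threshold T)).
    by apply: least_le; exists T.
  exact: least_le.
(* An optimum of at most [N] excludes vacuous recoverability: a set of that many workers exists, to
   which the lower bound applies. *)
have leKN := threshold_le _ _ linS recS; split.
  have [T linT thrT] := leastP (ex_linear_threshold F N hs hr ht).
  have recT := leastP (ex_recoverable T).
  rewrite -/(recovery_threshold T) thrT in recT.
  have [K cK] : exists K : {set 'I_N},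
      #|K| = optimum_linear_threshold F N hs hr ht.
    exists [set widen_ord leKN l | l : 'I__]%SET.
    rewrite card_imset ?card_ord // => l1 l2.
    by move=> /(congr1 val)/= /val_inj.
  apply: least_le; rewrite -cK.
  exact: linear_code_bilinear_algorithm linT (recT K cK).
have [leN|ltN] := leqP N (2 * bilinear_complexity F p m n - 1).
  exact: leq_trans leKN leN.
have R_gt0 := bilinear_complexity_gt0 F p_gt0 m_gt0 n_gt0.
have leRN : (bilinear_complexity F p m n <= N)%N.
  apply: leq_trans (ltnW ltN).
  by rewrite mul2n -addnn -addnBA // leq_addr.
have [a [b [c alg_abc]]] := leastP (ex_bilinear_algorithm F p m n).
(* The cardinality bound is an injection of the naturals below [N] into [F], transported here to
   ['I_N]. *)
have [y y_inj] : exists y : 'I_N -> F, injective y.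
  have /card_leP[f] := cardF.
  exists
    (fun i : 'I_N => val (f (SigSub (mem_set (ltn_ord i : `I_N i))))) => i j.
  by move=> /val_inj/(inj (mem_set I) (mem_set I))/(congr1 val)/=/val_inj.
apply: threshold_le (linear_entangled_code hs hr ht y leRN a b c) _.
exact: recoverable_entangled_code.
Qed.
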